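(* Let $\epsilon>0$. Then the set $$\left\{m\in\mathbb{Z}^+ \;\middle|\; \text{for all integers } k \text{ with } 0\leq k\leq \frac{\log_2 m}{1-\log_2\sqrt{3}}:\ \left(\tfrac{\sqrt{3}}{2}\right)^k m^{1-\epsilon}\leq \mathsf{T}^k(m)\leq \left(\tfrac{\sqrt{3}}{2}\right)^k m^{1+\epsilon}\right\}$$ is of natural density $1$.
   Context: $\mathbb{Z}^+$ is the set of positive integers. The map $\mathsf{T}:\mathbb{Z}^+\to\mathbb{Z}^+$ is defined by $\mathsf{T}(m)=\frac{m}{2}$ if $m$ is even and $\mathsf{T}(m)=\frac{3m+1}{2}$ if $m$ is odd; $\mathsf{T}^k$ denotes its $k$-fold iterate ($\mathsf{T}^0$ is the identity). A set $A\subseteq\mathbb{Z}^+$ is of natural density $1$ if $\liminf_{n\to\infty}\frac{\#\{m\in A\mid m\leq n\}}{n}=1$. *)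

(* Defs.v *)
From mathcomp Require Import all_boot all_order all_algebra.
From mathcomp Require Import all_classical all_reals all_analysis.

Set Implicit Arguments.
Unset Strict Implicit.
Unset Printing Implicit Defensive.

Import Order.TTheory GRing.Theory Num.Theory.

Local Open Scope classical_set_scope.
Local Open Scope ring_scope.

(* Positive integers are elements m : nat with 0 < m; the value at 0, which is
   0, is junk and is never reached from a positive starting point. *)
Definition collatzT (m : nat) : nat :=
  (if odd m then (3 * m + 1) %/ 2 else m %/ 2)%N.

Definition log2 {R : realType} (x : R) : R := ln x / ln 2.

Definition count_upto (A : set nat) (n : nat) : nat :=
  (\sum_(1 <= m < n.+1 | m \in A) 1)%N.

(* The liminf is taken in the extended reals; the term at n = 0 is
   0 / 0 = 0 and is irrelevant to it. *)
Definition natural_density_one (R : realType) (A : set nat) : Prop :=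
  limn_einf (fun n : nat => ((count_upto A n)%:R / n%:R : R)%:E) = 1%E.

(* Main.v *)
Require Import Defs.
From mathcomp Require Import all_boot all_order all_algebra.
From mathcomp Require Import all_classical all_reals all_analysis.
From mathcomp Require Import zify ring lra.

(** Write a_k(m) for the number of odd terms among the first k terms of the
    trajectory of m.  Then 2^k T^k(m) = 3^(a_k(m)) m + c_k(m) with an offset
    c_k(m) that is small as long as a_i(m) stays close to i/2, so the theorem
    reduces to: for almost all m, a_i(m) = i/2 + o(log m) uniformly for i up to
    the time when the expected size (sqrt 3 / 2)^i m has become m^(o(1)).

    For i <= log_2 m this is a large deviation estimate: the parities of the
    first i terms are equidistributed on blocks of 2^i integers
    ([sum_weight], [count_unbalanced]).  To go further, cut time into windows of
    h steps, with m < 2^(Q h) and Q a large constant, and argue window by window.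
    Suppose that the trajectories are balanced up to time k.  The next window is
    bad when n = T^k(m) lies in the set B of integers whose first h parities are
    unbalanced, and B has relative density at most rho^h with rho < 1.  What has
    to be excluded is that T^k sends far too many m into B.

    The key fact is a bound on preimages ([collatz_coding_inj]): m is determined
    by T^k(m), by a_k(m), and by the residue of m modulo 2^(k-j), as soon as the
    offset of the last j steps is less than 3^(a_k(m)).  Indeed two such m
    have offsets of the last j steps that are congruent modulo 3^(a_k(m)), hence
    equal.  For a balanced trajectory the offset of j steps is about 2^j, so that
    j may be taken with 2^j close to 3^(k/2).  Then every n has at most about
    2^(k-j), that is (2 / sqrt 3)^k, balanced preimages, which is the average
    number because the images have size at most (sqrt 3 / 2)^k 2^(Q h).  All
    losses are exponential in the tolerance D that was granted up to time k, and
    they are absorbed by rho^h once D / h is small enough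
    ([unbalanced_ratio_step]).  The number of windows is a constant, so the
    tolerances can be chosen backwards, from the last window to the first
    ([unbalanced_ratio_cvg0]).

    The windows stop when the expected size is below 2^h.  At most 5 h further
    steps are then relevant, and they multiply the iterate by at most 2^(5 h),
    which is less than m^eps for a suitable Q ([balanced_trajectory_bounds]).  *)

Set Implicit Arguments.
Unset Strict Implicit.
Unset Printing Implicit Defensive.

Import Order.TTheory GRing.Theory Num.Theory.
Import numFieldNormedType.Exports.

Local Open Scope nat_scope.

(** * Iterates as affine maps *)

Definition odd_steps (m k : nat) : nat := \sum_(i < k) odd (iter i collatzT m).

(** The inhomogeneous term c_k(m) of the affine identity [collatz_affine]. *)
Fixpoint offset (m k : nat) : nat :=
  if k is l.+1 then
    3 ^ odd (iter l collatzT m) * offset m l + odd (iter l collatzT m) * 2 ^ l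
  else 0.

Lemma collatzT_double m : 2 * collatzT m = 3 ^ odd m * m + odd m.
Proof.
rewrite /collatzT; have := odd_double_half m.
by case: (odd m) => /= ?; [rewrite expn1 | rewrite expn0]; lia.
Qed.

Lemma odd_stepsS m k :
  odd_steps m k.+1 = odd_steps m k + odd (iter k collatzT m).
Proof. exact: big_ord_recr. Qed.

Lemma odd_stepsSl m k :
  odd_steps m k.+1 = odd m + odd_steps (collatzT m) k.
Proof.
rewrite /odd_steps big_ord_recl; congr (_ + _).
by apply: eq_bigr => i _; rewrite -iterSr.
Qed.

Lemma odd_stepsD m i j :
  odd_steps m (i + j) = odd_steps m i + odd_steps (iter i collatzT m) j.
Proof.
elim: j => [|j IHj]; first by rewrite addn0 [X in _ + X]big_ord0 addn0.
by rewrite addnS !odd_stepsS IHj -addnA -iterD [j + i]addnC.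
Qed.

Lemma odd_steps_le m k : odd_steps m k <= k.
Proof.
elim: k => [|k IHk]; first by rewrite /odd_steps big_ord0.
by rewrite odd_stepsS -addn1 leq_add // leq_b1.
Qed.

Lemma collatz_affine m k :
  2 ^ k * iter k collatzT m = 3 ^ odd_steps m k * m + offset m k.
Proof.
elim: k => [|k IHk]; first by rewrite /odd_steps big_ord0 !mul1n addn0.
rewrite expnSr -mulnA iterS collatzT_double mulnDr mulnCA IHk odd_stepsS.
rewrite [offset m k.+1]/= expnD.
move: (3 ^ odd_steps m k) (3 ^ odd _) (offset m k) (2 ^ k) => a b c d.
ring.
Qed.

Lemma collatzT_gt0 m : (0 < m)%N -> (0 < collatzT m)%N.
Proof.
move=> m0; have := collatzT_double m.
by case: (odd m) => /=; rewrite ?expn1 ?expn0; lia.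
Qed.

Lemma iter_collatzT_gt0 k m : (0 < m)%N -> (0 < iter k collatzT m)%N.
Proof. by move=> m0; elim: k => //= k; apply: collatzT_gt0. Qed.

Lemma iter_collatzT_le k m : (iter k collatzT m <= 2 ^ k * m)%N.
Proof.
elim: k => [|k IHk]; first by rewrite mul1n.
have := collatzT_double (iter k collatzT m); rewrite iterS expnS -mulnA.
move: (iter k collatzT m) (2 ^ k * m)%N IHk => n X leX.
have : (odd n <= n)%N by case: (n) => // p; apply: leq_trans (leq_b1 _) _.
by case: (odd n) => /=; rewrite ?expn1 ?expn0; lia.
Qed.

Lemma collatzT_even n : collatzT (2 * n) = n.
Proof. by rewrite /collatzT oddM /= mulKn. Qed.

Lemma collatzT_odd n : collatzT (2 * n + 1) = 3 * n + 2.
Proof. by rewrite /collatzT oddD oddM /=; lia. Qed.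

(** * Few preimages: the injective coding *)

Lemma modn_collatzT n1 n2 l :
  n1 = n2 %[mod 2 ^ l.+1] ->
  odd n1 = odd n2 /\ collatzT n1 = collatzT n2 %[mod 2 ^ l].
Proof.
move=> eqn.
have eqo : odd n1 = odd n2.
  have := congr1 odd eqn.
  by rewrite !odd_mod // expnS oddM.
split=> //.
have /eqP : 2 * collatzT n1 = 2 * collatzT n2 %[mod 2 * 2 ^ l].
  rewrite !collatzT_double eqo -expnS -modnDml -modnMmr eqn modnMmr modnDml //.
by rewrite -!muln_modr eqn_pmul2l // => /eqP.
Qed.

(** The first l parities, and hence everything computed from them, depend only on
    the residue modulo 2^l. *)
Lemma modn_iter m1 m2 l :
  m1 = m2 %[mod 2 ^ l] ->
  odd_steps m1 l = odd_steps m2 l /\ offset m1 l = offset m2 l.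
Proof.
move=> eqm.
have key i : i <= l ->
   iter i collatzT m1 = iter i collatzT m2 %[mod 2 ^ (l - i)].
  elim: i => [|i IHi] ltil; first by rewrite subn0.
  have := IHi (ltnW ltil); rewrite -(subnSK ltil) => /modn_collatzT[_].
  by rewrite !iterS.
have eqo i : i < l -> odd (iter i collatzT m1) = odd (iter i collatzT m2).
  by move=> ltil; have := key i (ltnW ltil); rewrite -(subnSK ltil) => /modn_collatzT[].
split; first by apply: eq_bigr => i _; rewrite eqo.
elim: {-2}l (leqnn l) => // i IHi ltil /=.
by rewrite (IHi (ltnW ltil)) eqo.
Qed.

Lemma eqn_mod_pmul2l p m n d :
  coprime d p -> (p * m == p * n %[mod d]) = (m == n %[mod d]).
Proof.
move=> co_d_p; wlog leqnm : m n / n <= m.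
  move=> IH; case/orP: (leq_total n m) => leqmn; first exact: IH.
  by rewrite eq_sym [RHS]eq_sym IH.
by rewrite !eqn_mod_dvd ?leq_mul // -mulnBr Gauss_dvdr.
Qed.

(** With l = k - j, the two integers follow the same affine map for l steps, and
    the j last steps have the same number b of odd terms.  Eliminating the iterates
    at times l and k gives 2^l c1 + 3^a m1 = 2^l c2 + 3^a m2, where c1, c2 are the
    offsets of the last j steps and a = a_k(m1) = a_k(m2).  So c1 and c2 are
    congruent modulo 3^a, hence equal, and m1 = m2 follows. *)
Lemma collatz_coding_inj k j m1 m2 :
  j <= k ->
  m1 = m2 %[mod 2 ^ (k - j)] ->
  odd_steps m1 k = odd_steps m2 k ->
  iter k collatzT m1 = iter k collatzT m2 ->
  offset (iter (k - j) collatzT m1) j < 3 ^ odd_steps m1 k ->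
  offset (iter (k - j) collatzT m2) j < 3 ^ odd_steps m2 k ->
  m1 = m2.
Proof.
move=> lejk eqm eqa eqT lt1 lt2.
set l := k - j in eqm lt1 lt2; have def_k : k = l + j by rewrite subnK.
have [eqal eqcl] := modn_iter eqm.
have aff1 := collatz_affine m1 l; have aff2 := collatz_affine m2 l.
have := collatz_affine (iter l collatzT m1) j.
have := collatz_affine (iter l collatzT m2) j.
rewrite -!iterD [j + l]addnC -def_k -eqT => -> .
move: lt1 lt2; rewrite -eqa.
have def_a1 : odd_steps m1 k = odd_steps m1 l + odd_steps (iter l collatzT m1) j.
  by rewrite def_k odd_stepsD.
have def_a2 : odd_steps m1 k = odd_steps m1 l + odd_steps (iter l collatzT m2) j.
  by rewrite eqa def_k odd_stepsD eqal.
have eqb : odd_steps (iter l collatzT m2) j = odd_steps (iter l collatzT m1) j.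
  by apply: (@addnI (odd_steps m1 l)); rewrite -def_a1 -def_a2.
rewrite eqb {}def_a1; rewrite -eqal -eqcl in aff2; move: aff1 aff2.
set p1 := iter l collatzT m1; set p2 := iter l collatzT m2.
set b := odd_steps p1 j; set a := odd_steps m1 l; set c := offset m1 l.
set c1 := offset p1 j; set c2 := offset p2 j.
move=> aff1 aff2 lt1 lt2 eqn.
have eqc : 2 ^ l * c1 + 3 ^ (a + b) * m1 = 2 ^ l * c2 + 3 ^ (a + b) * m2.
  rewrite expnD; nia.
have/eqP : c1 = c2 %[mod 3 ^ (a + b)].
  have /eqP : 2 ^ l * c1 = 2 ^ l * c2 %[mod 3 ^ (a + b)].
    have := congr1 (modn^~ (3 ^ (a + b))) eqc.
    by rewrite ![_ + 3 ^ _ * _]addnC ![3 ^ _ * _]mulnC !modnMDl.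
  by rewrite eqn_mod_pmul2l ?coprimeXl ?coprimeXr // => /eqP.
rewrite !modn_small // => /eqP eqc12.
by move/eqP: eqc; rewrite eqc12 eqn_add2l eqn_pmul2l ?expn_gt0 // => /eqP.
Qed.

Definition count_below (P : pred nat) (n : nat) : nat := count P (iota 0 n).

Lemma count_below_sum P n : count_below P n = \sum_(m < n) P m.
Proof.
rewrite /count_below -sum1_count -{1}(subn0 n) -/(index_iota 0 n) big_mkcond big_mkord.
by apply: eq_bigr => i _; case: (P i).
Qed.

Lemma count_below_mono P n1 n2 : n1 <= n2 -> count_below P n1 <= count_below P n2.
Proof. by move=> le12; rewrite /count_below -(subnKC le12) iotaD count_cat leq_addr. Qed.

Lemma count_below_subU (P Q S : pred nat) n :
  (forall m, m < n -> P m -> Q m || S m) ->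
  count_below P n <= count_below Q n + count_below S n.
Proof.
move=> PQS; rewrite !count_below_sum -big_split leq_sum // => m _.
by have := PQS m (ltn_ord m); case: (P m) => // /(_ isT); case: (Q m); case: (S m).
Qed.

(** The counting form of [collatz_coding_inj]: there are 2^(k-j) residues, k + 1
    numbers of odd terms, and the iterates are elements of B below M. *)
Lemma count_preimage (B G : pred nat) X M k j : j <= k ->
  (forall m, m < X -> G m ->
     [/\ B (iter k collatzT m), iter k collatzT m < M
       & offset (iter (k - j) collatzT m) j < 3 ^ odd_steps m k]) ->
  count_below G X <= 2 ^ (k - j) * k.+1 * count_below B M.
Proof.
move=> lejk GP.
pose code m := (m %% 2 ^ (k - j), (odd_steps m k, iter k collatzT m)).
pose codes := [seq (r, u) | r <- iota 0 (2 ^ (k - j)),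
   u <- [seq (a, n) | a <- iota 0 k.+1, n <- [seq n <- iota 0 M | B n]]].
have -> : 2 ^ (k - j) * k.+1 * count_below B M = size codes.
  by rewrite !size_allpairs !size_iota size_filter mulnA.
have inG m : m \in [seq m <- iota 0 X | G m] -> m < X /\ G m.
  by rewrite mem_filter mem_iota add0n => /and3P[].
rewrite /count_below -size_filter -(size_map code); apply: uniq_leq_size.
  rewrite map_inj_in_uniq ?filter_uniq ?iota_uniq //.
  move=> m1 m2 /inG[lt1 G1] /inG[lt2 G2] [eqr eqa eqT].
  have [_ _ off1] := GP _ lt1 G1; have [_ _ off2] := GP _ lt2 G2.
  exact: (collatz_coding_inj lejk).
move=> _ /mapP[m /inG[ltm Gm] ->]; have [Bm ltM _] := GP _ ltm Gm.
apply: allpairs_f; first by rewrite mem_iota ltn_mod expn_gt0.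
apply: allpairs_f; first by rewrite mem_iota ltnS odd_steps_le.
by rewrite mem_filter mem_iota Bm.
Qed.

(** * Balanced trajectories *)

(** The tolerance D bounds |2 a_i(m) - i| at all times i <= K, not only at time K:
    intermediate control is what keeps the offset small. *)
Definition balanced (D K m : nat) : bool :=
  [forall i : 'I_K.+1, (i <= 2 * odd_steps m i + D) && (2 * odd_steps m i <= i + D)].

Lemma balancedP D K m :
  reflect (forall i, i <= K ->
             (i <= 2 * odd_steps m i + D) /\ (2 * odd_steps m i <= i + D))
          (balanced D K m).
Proof.
apply: (iffP forallP) => [bal i leiK | bal i].
  by have /andP[] := bal (Ordinal (leiK : i < K.+1)).
by apply/andP/bal; rewrite -ltnS.
Qed.

Lemma balanced0 D m : balanced D 0 m.
Proof.
apply/balancedP => i; rewrite leqn0 => /eqP ->.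
by rewrite /odd_steps big_ord0.
Qed.

Lemma balanced_extend D1 D2 D k h m : (D1 + D2 <= D) ->
  balanced D1 k m -> balanced D2 h (iter k collatzT m) ->
  balanced D (k + h) m.
Proof.
move=> leD /balancedP bal1 /balancedP bal2; apply/balancedP => i leikh.
have [leik|/ltnW leki] := leqP i k; first by have := bal1 i leik; lia.
have lei : (i - k <= h) by lia.
rewrite -(subnKC leki) odd_stepsD.
have := bal1 k (leqnn k); have := bal2 _ lei; lia.
Qed.

(** A step at time i contributes 2^i to the offset, multiplied by 3 for each later
    odd term.  The hypothesis leaves at most half as many odd terms as there are
    later steps, up to E, and sqrt 3 < 2 makes the contributions increase with i up
    to the factor 2^E. *)
Lemma offset_le p j E :
  (forall i, i <= j -> 2 * odd_steps p j <= 2 * odd_steps p i + (j - i) + E) ->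
  offset p j <= j * 2 ^ (j + E).
Proof.
move=> tailE.
suff: forall i, i <= j ->
    3 ^ (odd_steps p j - odd_steps p i) * offset p i <= i * 2 ^ (j + E).
  by move/(_ j (leqnn j)); rewrite subnn mul1n.
elim=> [|i IHi] ltij; first by rewrite muln0.
have le_aj : odd_steps p i.+1 <= odd_steps p j.
  by rewrite -(subnKC ltij) odd_stepsD leq_addr.
have le_ai : odd_steps p i <= odd_steps p i.+1 by rewrite odd_stepsS leq_addr.
rewrite /= mulnDr mulSn addnC leq_add //.
  apply: (@leq_trans (3 ^ (odd_steps p j - odd_steps p i.+1) * 2 ^ i)).
    by rewrite leq_mul2l; apply/orP; right; case: odd; rewrite ?mul1n ?mul0n.
  rewrite -(@leq_exp2r _ _ 2) // expnMn -!expnM.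
  have le34 n : 3 ^ n <= 2 ^ (n * 2).
    by rewrite mulnC expnM; case: n => // n; rewrite leq_exp2r.
  set e := _ - _; have le_e2 : e * 2 <= j - i.+1 + E.
    by have := tailE _ ltij; rewrite /e; lia.
  apply: (@leq_trans (2 ^ ((j - i.+1 + E) * 2) * 2 ^ (i * 2))).
    by rewrite leq_mul2r (leq_trans _ (le34 _)) ?orbT // leq_exp2l.
  by rewrite -expnD leq_exp2l //; lia.
rewrite mulnA -expnD; apply: leq_trans (IHi (ltnW ltij)).
by rewrite leq_mul2r leq_exp2l // odd_stepsS in le_aj *; lia.
Qed.

Lemma offset_balanced D k m j : j <= k -> balanced D k m ->
  offset (iter (k - j) collatzT m) j <= j * 2 ^ (j + 2 * D).
Proof.
move=> lejk /balancedP bal; apply: offset_le => i leij.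
have [_ hi] := bal k (leqnn k).
have leik : k - j + i <= k by lia.
have [lo _] := bal _ leik.
have := odd_stepsD m (k - j) j; have := odd_stepsD m (k - j) i.
rewrite subnK // in lo hi *; lia.
Qed.

Lemma iter_collatzT_lt D k m X : balanced D k m -> m < X ->
  iter k collatzT m < (3 ^ (k + D)./2 * X) %/ 2 ^ k + k * 4 ^ D + 1.
Proof.
move=> bal ltm; have off := offset_balanced (leqnn k) bal.
have {}off : offset m k <= k * 4 ^ D * 2 ^ k.
  by move: off; rewrite subnn expnD expnM -mulnA [4 ^ D * _]mulnC.
have aff := collatz_affine m k.
have [_ hi] := balancedP _ _ _ bal k (leqnn k).
have le3 : 3 ^ odd_steps m k <= 3 ^ (k + D)./2 by rewrite leq_exp2l //; lia.
have lemX : 3 ^ odd_steps m k * m <= 3 ^ (k + D)./2 * X.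
  by rewrite leq_mul // ltnW.
rewrite addn1 ltnS addnC -leq_subLR leq_divRL ?expn_gt0 //.
by rewrite mulnBl mulnC aff leq_subLR addnC leq_add.
Qed.

(** The choice of j in [collatz_coding_inj]: 2^j has to be below 3^(k/2) for the
    injectivity and, for the count, not much smaller than that.  The additional
    factors make room for the offset bound j 2^(j + 2 D) and for a_k >= (k - D) / 2. *)
Lemma exists_split_time D k : exists j, [/\ j <= k,
  j ^ 2 * 4 ^ (j + 2 * D) * 3 ^ D < 3 ^ k &
  3 ^ k < 4 ^ j.+1 * k.+1 ^ 2 * 4 ^ (3 * D)].
Proof.
pose Y := k.+1 ^ 2 * 4 ^ (3 * D); have Y0 : 0 < Y by rewrite muln_gt0 !expn_gt0.
exists (trunc_log 4 (3 ^ k %/ Y)); have [X0|X0] := posnP (3 ^ k %/ Y).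
  rewrite X0 trunc_log0 expn_gt0; split=> //.
  have : 3 ^ k < Y by move/eqP: X0; rewrite -leqn0 leqNgt divn_gt0 // -ltnNge.
  rewrite /Y -mulnA; lia.
have := trunc_logP (isT : 1 < 4) X0.
have := trunc_log_ltn (3 ^ k %/ Y) (isT : 1 < 4).
set j := trunc_log _ _; rewrite ltn_divLR // leq_divRL // => ltj lej.
have lejk : j <= k.
  rewrite -(leq_exp2l _ _ (isT : 1 < 4)); apply: (@leq_trans (3 ^ k)).
    by apply: leq_trans lej; rewrite leq_pmulr.
  by case: (k) => // n; rewrite leq_exp2r.
split=> //; last by rewrite -mulnA.
apply: leq_trans lej; rewrite /Y.
have -> : 4 ^ (3 * D) = 4 ^ (2 * D) * 4 ^ D by rewrite -expnD; congr (_ ^ _); lia.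
have le34 : 3 ^ D <= 4 ^ D by case: (D) => // n; rewrite leq_exp2r.
apply: (@leq_ltn_trans (j ^ 2 * 4 ^ (j + 2 * D) * 4 ^ D)).
  by rewrite leq_mul2l le34 orbT.
rewrite (expnD 4 j) [X in _ < X]mulnCA (mulnA (4 ^ j)) (mulnA (k.+1 ^ 2)).
rewrite !ltn_pmul2r ?muln_gt0 ?expn_gt0 //.
by rewrite ltn_exp2r.
Qed.

Lemma count_balanced_preimage (B : pred nat) D k N j : j <= k ->
  j ^ 2 * 4 ^ (j + 2 * D) * 3 ^ D < 3 ^ k ->
  count_below (fun m => balanced D k m && B (iter k collatzT m)) (2 ^ N) <=
  2 ^ (k - j) * k.+1 *
    count_below B ((3 ^ (k + D)./2 * 2 ^ N) %/ 2 ^ k + k * 4 ^ D + 1).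
Proof.
move=> lejk jP; apply: count_preimage => // m ltm /andP[bal Bm]; split=> //.
  exact: iter_collatzT_lt.
have [lo _] := balancedP _ _ _ bal k (leqnn k).
apply: leq_ltn_trans (offset_balanced lejk bal) _.
rewrite -(ltn_exp2r _ _ (isT : 0 < 2)) -(@ltn_pmul2r (3 ^ D)) ?expn_gt0 //.
rewrite expnMn -expnM [(j + _) * 2]mulnC [2 ^ (2 * _)]expnM.
apply: leq_trans jP _.
by rewrite -expnM -expnD leq_exp2l // mulnC.
Qed.

Local Open Scope classical_set_scope.
Local Open Scope ring_scope.

(** * Unbalanced parities are exponentially rare *)

Section Weight.
Variable R : comNzRingType.

(** With x = 1 / y, the sums of these weights over n are the exponential moments
    of 2 a_k(n) - k. *)
Definition weight (x y : R) (k n : nat) : R :=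
  x ^+ (k - odd_steps n k) * y ^+ odd_steps n k.

Lemma weightS x y k n :
  weight x y k.+1 n = (if odd n then y else x) * weight x y k (collatzT n).
Proof.
rewrite /weight odd_stepsSl; have := odd_steps_le (collatzT n) k.
set a := odd_steps _ _ => leak.
case: (odd n); last by rewrite add0n subSn // exprS mulrA.
by rewrite add1n subSS exprS; ring.
Qed.

Lemma sum_double (f : nat -> R) n :
  \sum_(p < 2 * n) f p = \sum_(q < n) (f (2 * q)%N + f (2 * q + 1)%N).
Proof.
elim: n => [|n IHn]; first by rewrite muln0 !big_ord0.
rewrite [RHS]big_ord_recr /= -IHn mulnS add2n [LHS]big_ord_recr.
by rewrite [X in X + _ = _]big_ord_recr /= addn1 addrA.
Qed.

(** Equidistribution of the first k parities, as a generating function.  The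
    statement is for arithmetic progressions of odd difference c because the
    even and odd halves of such a progression are mapped by T to progressions with
    differences c and 3 c, again odd. *)
Lemma sum_weight x y k c d : odd c ->
  \sum_(p < 2 ^ k) weight x y k (c * p + d) = (x + y) ^+ k.
Proof.
elim: k c d => [|k IHk] c d odd_c.
  by rewrite big_ord1 /weight /odd_steps big_ord0 mulr1.
rewrite expnS (sum_double (fun p => weight x y k.+1 (c * p + d))) big_split /=.
have odd3c : odd (3 * c) by rewrite oddM odd_c.
have half e : e = (odd e + 2 * e./2)%N by rewrite mul2n odd_double_half.
have sum_even e : ~~ odd e ->
    \sum_(q < 2 ^ k) weight x y k.+1 (2 * c * q + e) = x * (x + y) ^+ k.
  move=> oe; rewrite -(IHk c e./2) // mulr_sumr; apply: eq_bigr => q _.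
  rewrite weightS {1 2}(half e) (negbTE oe) add0n -mulnA -mulnDr.
  by rewrite oddM /= collatzT_even.
have sum_odd e : odd e ->
    \sum_(q < 2 ^ k) weight x y k.+1 (2 * c * q + e) = y * (x + y) ^+ k.
  move=> oe; rewrite -(IHk (3 * c)%N (3 * e./2 + 2)%N) // mulr_sumr.
  apply: eq_bigr => q _.
  rewrite weightS {1 2}(half e) oe -mulnA addnCA addnC -mulnDr.
  by rewrite oddD oddM /= collatzT_odd mulnDr addnA mulnA.
have -> : \sum_(q < 2 ^ k) weight x y k.+1 (c * (2 * q) + d) =
    \sum_(q < 2 ^ k) weight x y k.+1 (2 * c * q + d).
  by apply: eq_bigr => q _; rewrite mulnA [(c * 2)%N]mulnC.
have -> : \sum_(q < 2 ^ k) weight x y k.+1 (c * (2 * q + 1) + d) =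
    \sum_(q < 2 ^ k) weight x y k.+1 (2 * c * q + (c + d)).
  by apply: eq_bigr => q _; rewrite mulnDr mulnA [(c * 2)%N]mulnC muln1 addnA.
have [od | ed] := boolP (odd d).
  by rewrite sum_odd // sum_even ?oddD ?odd_c ?od // -mulrDl addrC exprS.
by rewrite sum_even // sum_odd ?oddD ?odd_c ?(negbTE ed) // -mulrDl exprS.
Qed.

Lemma sum_weight_below x y k L :
  \sum_(p < L * 2 ^ k) weight x y k p = L%:R * (x + y) ^+ k.
Proof.
elim: L => [|L IHL]; first by rewrite mul0n big_ord0 mul0r.
rewrite mulSn addnC big_split_ord /= IHL -(@sum_weight x y k 1 (L * 2 ^ k)) //.
rewrite -[L.+1]addn1 natrD mulrDl mul1r; congr (_ + _).
by apply: eq_bigr => p _; rewrite mul1n addnC.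
Qed.
End Weight.

Lemma exp1D_le (R : realFieldType) (s : R) b :
  0 <= s <= 1 -> (1 + s) ^+ b <= 1 + (2 ^+ b - 1) * s.
Proof.
move=> /andP[s0 s1]; elim: b => [|b IHb]; first by rewrite !expr0; lra.
have y0 : 0 <= 1 + s by lra.
rewrite [leLHS]exprSr; apply: le_trans (ler_wpM2r y0 IHb) _.
have : 1 <= 2 ^+ b :> R by rewrite exprn_ege1 // ler1n.
rewrite [2 ^+ b.+1]exprS; move: (2 ^+ b) => B B1.
have : 0 <= (B - 1) * (s * (1 - s)) by rewrite !mulr_ge0 //; lra.
lra.
Qed.

(** The exponential moment per step, cosh (b t) with y = exp t, is 1 + O(t^2),
    whereas y gains a term linear in t; so a small tilt works. *)
Lemma exists_tilt (R : realFieldType) (b : nat) :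
  exists2 y : R, 1 < y & y ^+ b + (y ^+ b)^-1 < 2 * y.
Proof.
(* With u = (1 + s)^b - 1 <= 2^b s, this s makes u^2 <= s. *)
pose s : R := (4 ^+ b)^-1.
have B1 : 1 <= 2 ^+ b :> R by rewrite exprn_ege1 // ler1n.
have BB : 4 ^+ b = 2 ^+ b * 2 ^+ b :> R by rewrite -exprMn; congr (_ ^+ b); ring.
have s0 : 0 < s by rewrite invr_gt0 exprn_gt0.
have s1 : s <= 1 by rewrite invf_le1 ?exprn_gt0 // BB; nra.
exists (1 + s); first lra.
have y1 : 1 <= 1 + s by lra.
have z1 : 1 <= (1 + s) ^+ b by rewrite exprn_ege1.
have zle : (1 + s) ^+ b <= 1 + 2 ^+ b * s.
  have := @exp1D_le R s b; rewrite s1 ltW // => /(_ isT); lra.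
set z := (1 + s) ^+ b in z1 zle *.
have sBB : s * (2 ^+ b * 2 ^+ b) = 1.
  by rewrite -BB mulVf // gt_eqF // exprn_gt0.
have u2 : (z - 1) * (z - 1) <= s.
  apply: (@le_trans _ _ ((2 ^+ b * s) * (2 ^+ b * s))).
    by apply: ler_pM; lra.
  by rewrite mulrACA mulrA -[X in X * s]mulrC sBB mul1r.
have -> : z + z^-1 = 2 + (z - 1) * (z - 1) * z^-1 by field; lra.
have : (z - 1) * (z - 1) * z^-1 <= s.
  by apply: le_trans u2; rewrite ler_piMr ?mulr_ge0 ?invf_le1; lra.
lra.
Qed.

Lemma weight_ge0 (R : realFieldType) (x y : R) k n :
  0 <= x -> 0 <= y -> 0 <= weight x y k n.
Proof. by move=> x0 y0; rewrite mulr_ge0 ?exprn_ge0. Qed.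

(** An unbalanced time i has |2 a_i(n) - i| > h / q, so one of the two weights at
    that time is at least (y^q)^(h / q). *)
Lemma unbalanced_weight (R : realFieldType) (y : R) q h n :
  (0 < q)%N -> 1 <= y -> ~~ balanced (h %/ q) h n ->
  y ^+ h <= \sum_(i < h.+1) (weight (y ^+ q)^-1 (y ^+ q) i n
                           + weight (y ^+ q) (y ^+ q)^-1 i n).
Proof.
move=> q0 y1 /forallPn /= [i].
have : (h < (h %/ q).+1 * q)%N by rewrite -ltn_divLR.
move: (h %/ q)%N => D lth.
have y0 : 0 < y by lra.
have z0 : 0 <= y ^+ q by rewrite exprn_ge0 // ltW.
have w0 (j : 'I_h.+1) : 0 <= weight (y ^+ q)^-1 (y ^+ q) j n
                           + weight (y ^+ q) (y ^+ q)^-1 j n.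
  by rewrite addr_ge0 ?weight_ge0 ?invr_ge0.
rewrite (bigD1 i) //= negb_and -!ltnNge => dev.
rewrite -[leLHS]addr0 lerD ?sumr_ge0 //.
have tilt u v : (u + D < v)%N -> y ^+ h <= (y ^+ q)^-1 ^+ u * y ^+ q ^+ v.
  move=> ltuv; have leuv : (u <= v)%N by lia.
  rewrite -(subnK leuv) addnC exprD mulrA -exprMn mulVf ?expf_neq0 ?gt_eqF //.
  rewrite expr1n mul1r.
  rewrite -exprM ler_weXn2l //.
  have ledev : (D.+1 <= v - u)%N by lia.
  by apply: leq_trans (ltnW lth) _; rewrite mulnC leq_mul2l ledev orbT.
have leai := odd_steps_le n i; case/orP: dev => dev.
  apply: (@le_trans _ _ (weight (y ^+ q) (y ^+ q)^-1 i n)).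
    by rewrite /weight mulrC tilt //; lia.
  by rewrite lerDr weight_ge0 ?invr_ge0.
apply: (@le_trans _ _ (weight (y ^+ q)^-1 (y ^+ q) i n)).
  by rewrite /weight tilt //; lia.
by rewrite lerDl weight_ge0 ?invr_ge0.
Qed.

(** Chernoff bound, with a union over the times i <= h.  Aligned intervals suffice:
    2^h consecutive integers contain 2^(h-i) full blocks of length 2^i. *)
Lemma count_unbalanced (R : realFieldType) (q : nat) : (0 < q)%N ->
  exists2 rho : R, 0 < rho < 1 & forall h L,
    (count_below (fun n => ~~ balanced (h %/ q) h n) (L * 2 ^ h))%:R
      <= 2 * h.+1%:R * rho ^+ h * (L * 2 ^ h)%:R.
Proof.
move=> q0; have [y y1 ylt] := exists_tilt R q.
have y0 : 0 < y by lra.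
have z0 : 0 < y ^+ q by rewrite exprn_gt0.
set z := y ^+ q in ylt z0; set chi := (z + z^-1) / 2.
have zz : z * z^-1 = 1 by rewrite mulfV // gt_eqF.
have zV0 : 0 < z^-1 by rewrite invr_gt0.
have z1 : 1 <= z by rewrite exprn_ege1 // ltW.
have chi1 : 1 <= chi.
  have : 0 <= (z - 1) * (1 - z^-1).
    by rewrite mulr_ge0 // subr_ge0 // invf_le1 // ltW.
  by rewrite /chi; lra.
have chiy : chi < y by rewrite /chi; lra.
exists (chi / y).
  by rewrite divr_gt0 //=; [rewrite ltr_pdivrMr ?mul1r | lra].
move=> h L.
rewrite expr_div_n mulrA mulrAC ler_pdivlMr ?exprn_gt0 //.
pose w i n := weight z^-1 z i n + weight z z^-1 i n.
apply: (@le_trans _ _ (\sum_(n < L * 2 ^ h) \sum_(i < h.+1) w i n)).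
  rewrite count_below_sum natr_sum mulr_suml; apply: ler_sum => n _.
  case: (boolP (balanced _ _ _)) => unb.
    by rewrite mul0r sumr_ge0 // => i _; rewrite addr_ge0 ?weight_ge0 ?ltW.
  by rewrite mul1r; apply: unbalanced_weight => //; apply: ltW.
rewrite exchange_big /=.
have -> : 2 * h.+1%:R * chi ^+ h * (L * 2 ^ h)%:R =
   \sum_(i < h.+1) 2 * (chi ^+ h * (L * 2 ^ h)%:R).
  by rewrite sumr_const card_ord -mulr_natl; ring.
apply: ler_sum => i _; rewrite big_split /=.
have leih : (i <= h)%N by rewrite -ltnS.
have -> : (L * 2 ^ h = L * 2 ^ (h - i) * 2 ^ i)%N by rewrite -mulnA -expnD subnK.
rewrite !sum_weight_below [z + _]addrC -mulr2n -[_ *+ 2]mulr_natl.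
have -> : z^-1 + z = 2 * chi by rewrite /chi; field; rewrite gt_eqF.
rewrite exprMn !natrM !natrX ler_wpM2l // [leRHS]mulrC -!mulrA.
by rewrite !ler_wpM2l ?exprn_ge0 // ler_weXn2l.
Qed.

(** * Powers of the square root of 3 *)

Section Sqrt3.
Variable R : rcfType.
Implicit Types k : nat.
Local Notation s := (Num.sqrt 3 : R).

Lemma sqrt3_sqr : s * s = 3.
Proof. by rewrite -expr2 sqr_sqrtr. Qed.

Lemma sqrt3_gt1 : 1 < s.
Proof. by rewrite -[ltLHS]sqrtr1 ltr_sqrt // ltr1n. Qed.

Lemma sqrt3_lt2 : s < 2.
Proof. have := sqrt3_sqr; have := sqrt3_gt1; nra. Qed.

Lemma sqrt3_expr_sqr k : (s ^+ k) ^+ 2 = 3 ^+ k.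
Proof. by rewrite exprAC expr2 sqrt3_sqr. Qed.

Lemma sqrt3_expr_ge (k : nat) (x : R) : 0 <= x -> (3 ^ k)%:R <= x ^+ 2 ->
  s ^+ k <= x.
Proof.
move=> x0; rewrite natrX -sqrt3_expr_sqr ler_sqr // nnegrE exprn_ge0 //.
Qed.

Lemma sqrt3_expr_le (k : nat) (x : R) : 0 <= x -> x ^+ 2 <= (3 ^ k)%:R ->
  x <= s ^+ k.
Proof.
move=> x0; rewrite natrX -sqrt3_expr_sqr ler_sqr // nnegrE exprn_ge0 //.
Qed.

Lemma three_half_le k D : (3 ^ (k + D)./2)%:R <= s ^+ k * 2 ^+ D.
Proof.
have s0 : 0 <= s by rewrite sqrtr_ge0.
apply: (@le_trans _ _ (s ^+ (k + D))).
  apply: sqrt3_expr_le => //; rewrite -natrX ler_nat -expnM leq_exp2l //; lia.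
rewrite exprD ler_wpM2l ?exprn_ge0 // lerXn2r ?nnegrE //.
by rewrite ltW // sqrt3_lt2.
Qed.

End Sqrt3.

(** * One more window of steps *)

(** The window estimate, with N = Q h and k = r h.  There are at most about
    (2 / sqrt 3)^k preimages per element of B, and the balanced images lie below
    about (sqrt 3 / 2)^k 2^N, where B has relative density rho^h.  The first
    hypothesis says that (sqrt 3 / 2)^k 2^N >= 2^h, so that intervals of length 2^h
    still resolve this range.  Polynomial factors in h are absorbed in 2^(4 D) at
    the price of the factor q^4. *)
Lemma count_preimage_unbalanced (R : rcfType) (rho : R) (B : pred nat) Q r q D h :
  (4 ^ r.+1 <= 3 ^ r * 4 ^ Q)%N -> (h < D.+1 * q)%N -> 0 < rho ->
  (forall L, (count_below B (L * 2 ^ h))%:R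
     <= 2 * h.+1%:R * rho ^+ h * (L * 2 ^ h)%:R) ->
  (count_below (fun m => balanced D (r * h) m && B (iter (r * h) collatzT m))
     (2 ^ (Q * h)))%:R
   <= 12 * (r.+1%:R ^+ 3) * q%:R ^+ 4 * (512 ^+ D * rho ^+ h) * 2 ^+ (Q * h) :> R.
Proof.
move=> leQ ltq rho0 Brho.
have [j [lejk jlo jhi]] := exists_split_time D (r * h).
have := count_balanced_preimage B (Q * h) lejk jlo.
set k := (r * h)%N in lejk jlo jhi *; set N := (Q * h)%N.
set M := (_ + 1)%N => cnt.
set cntR := (X in X%:R <= _); rewrite -/cntR in cnt.
pose S : R := Num.sqrt 3 ^+ k; pose P : R := 2 ^+ k.
pose X : R := 2 ^+ N; pose H : R := 2 ^+ h.
pose A : R := 2 ^+ (k - j); pose V := S * X / P.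
have s0 : 0 < Num.sqrt 3 :> R by rewrite sqrtr_gt0.
have [S0 P0 X0 H0 A0] : [/\ 0 < S, 0 < P, 0 < X, 0 < H & 0 < A].
  by split; rewrite exprn_gt0.
have e4 n : (4 ^ n = (2 ^ n) ^ 2)%N by rewrite -expnM mulnC expnM.
have AS : A * S <= P * (2 * k.+1%:R * 8 ^+ D).
  have : S <= 2 ^+ j.+1 * k.+1%:R * 8 ^+ D.
    apply: sqrt3_expr_ge; first by rewrite !mulr_ge0 ?exprn_ge0.
    rewrite !exprMn -!natrX -!natrM ler_nat; apply: leq_trans (ltnW jhi) _.
    by rewrite !e4 [(2 ^ (3 * D))%N]expnM.
  move=> /(ler_wpM2l (ltW A0)) /le_trans; apply.
  have -> : P = A * 2 ^+ j by rewrite -exprD subnK.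
  by rewrite exprS le_eqVlt; apply/orP; left; apply/eqP; ring.
have HV : H <= V.
  rewrite ler_pdivlMr // /H /P -exprD -ler_pdivrMr ?exprn_gt0 //.
  apply: sqrt3_expr_le; first by rewrite divr_ge0 ?exprn_ge0.
  rewrite expr_div_n ler_pdivrMr ?exprn_gt0 // /X -!natrX -natrM ler_nat.
  rewrite -!e4; have : ((4 ^ r.+1) ^ h <= (3 ^ r * 4 ^ Q) ^ h)%N.
    by case: (h) => // h'; rewrite leq_exp2r.
  by rewrite expnMn -!expnM mulSn.
have H1 : 1 <= H by rewrite exprn_ege1 ?ler1n.
have D4 : 1 <= 4 ^+ D :> R by rewrite exprn_ege1 ?ler1n.
have D24 : 2 ^+ D <= 4 ^+ D :> R by rewrite lerXn2r ?nnegrE ?ler_nat.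
have leM : M%:R <= V * 2 ^+ D + k%:R * 4 ^+ D + 1.
  rewrite /M !natrD natrM natrX lerD2r lerD2r.
  apply: (@le_trans _ _ ((3 ^ (k + D)./2 * 2 ^ N)%:R / P)).
    rewrite ler_pdivlMr // /P -natrX -natrM ler_nat; exact: leq_trunc_div.
  have -> : V * 2 ^+ D = S * 2 ^+ D * (X / P) by rewrite /V; ring.
  rewrite natrM (natrX R 2 N) -/X -mulrA ler_wpM2r ?three_half_le //.
  by rewrite ltW // divr_gt0.
have leMH : M%:R + H <= V * 4 ^+ D * (k%:R + 3).
  have V1 : 1 <= V by apply: le_trans HV.
  have : V * 2 ^+ D <= V * 4 ^+ D by rewrite ler_wpM2l //; lra.
  have : k%:R * 4 ^+ D <= V * (k%:R * 4 ^+ D).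
    by rewrite ler_peMl // mulr_ge0 ?ler0n ?exprn_ge0.
  have : V <= V * 4 ^+ D by rewrite ler_peMr //; lra.
  lra.
have leL : (M <= (M %/ 2 ^ h + 1) * 2 ^ h)%N.
  by rewrite mulnDl mul1n {1}(divn_eq M (2 ^ h)) leq_add2l ltnW // ltn_mod expn_gt0.
have leL2 : ((M %/ 2 ^ h + 1) * 2 ^ h)%:R <= M%:R + H :> R.
  by rewrite mulnDl mul1n natrD natrX lerD2r ler_nat leq_trunc_div.
have leB : (count_below B M)%:R
    <= 2 * h.+1%:R * rho ^+ h * (V * 4 ^+ D * (k%:R + 3)).
  apply: (@le_trans _ _ (count_below B ((M %/ 2 ^ h + 1) * 2 ^ h))%:R).
    by rewrite ler_nat count_below_mono.
  apply: le_trans (Brho _) _; rewrite ler_wpM2l ?mulr_ge0 ?exprn_ge0 ?ler0n //.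
    exact: ltW.
  exact: le_trans leL2 leMH.
have leAV : A * V <= X * (2 * k.+1%:R * 8 ^+ D).
  by rewrite /V mulrA ler_pdivrMr //; have := ler_wpM2l (ltW X0) AS; lra.
have cntR_le : cntR%:R
  <= A * k.+1%:R * (2 * h.+1%:R * rho ^+ h * (V * 4 ^+ D * (k%:R + 3))).
  apply: (@le_trans _ _ (A * k.+1%:R * (count_below B M)%:R)).
    by rewrite /A -natrX -!natrM ler_nat.
  by rewrite ler_wpM2l // mulr_ge0 ?ler0n // ltW.
apply: le_trans cntR_le _.
have kr : k.+1%:R <= r.+1%:R * h.+1%:R :> R.
  by rewrite -natrM ler_nat mulSn mulnS addnA !addSn ltnS leq_addl.
have k3 : k%:R + 3 <= 3 * k.+1%:R :> R by rewrite -natr1; have := ler0n R k; lra.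
have hq : h.+1%:R <= q%:R * 2 ^+ D :> R.
  rewrite -natrX -natrM ler_nat; apply: leq_trans ltq _.
  by rewrite mulnC leq_mul2l ltn_expl // orbT.
set E8 : R := 8 ^+ D in leAV; set E4 : R := 4 ^+ D; set E2 : R := 2 ^+ D in hq.
have E512 : 512 ^+ D = E8 * E4 * E2 ^+ 4 :> R.
  by rewrite -exprM mulnC exprM -!exprMn; congr (_ ^+ _); ring.
have E80 : 0 < E8 by rewrite exprn_gt0.
have E40 : 0 < E4 by rewrite exprn_gt0.
have E20 : 0 < E2 by rewrite exprn_gt0.
have rh0 : 0 < rho ^+ h by rewrite exprn_gt0.
set rh := rho ^+ h in rh0 *; set k1 : R := k.+1%:R in leAV kr k3 *.
set h1 : R := h.+1%:R in kr hq *; set r1 : R := r.+1%:R in kr *.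
have [k10 h10 r10] : [/\ 0 < k1, 0 < h1 & 0 < r1] by split; rewrite ltr0n.
apply: (@le_trans _ _ (A * V * (2 * k1 * h1 * rh * E4 * (3 * k1)))).
  have -> : A * k1 * (2 * h1 * rh * (V * E4 * (k%:R + 3)))
      = A * V * (2 * k1 * h1 * rh * E4 * (k%:R + 3)) by ring.
  have V0 : 0 < V by apply: lt_le_trans HV.
  have AV0 : 0 <= A * V by rewrite mulr_ge0 // ltW.
  by rewrite (ler_wpM2l AV0) // ler_wpM2l // !mulr_ge0 // ltW.
apply: (@le_trans _ _ (X * (2 * k1 * E8) * (2 * k1 * h1 * rh * E4 * (3 * k1)))).
  by rewrite ler_wpM2r ?mulr_ge0 // ltW.
have -> : X * (2 * k1 * E8) * (2 * k1 * h1 * rh * E4 * (3 * k1))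
   = 12 * X * E8 * E4 * rh * (k1 ^+ 3 * h1) by ring.
have -> : 12 * r1 ^+ 3 * q%:R ^+ 4 * (512 ^+ D * rh) * 2 ^+ N
   = 12 * X * E8 * E4 * rh * (r1 ^+ 3 * (q%:R * E2) ^+ 4) by rewrite E512 -/X; ring.
have c0 : 0 <= 12 * X * E8 * E4 * rh by rewrite !mulr_ge0 // ltW.
rewrite (ler_wpM2l c0) //; apply: (@le_trans _ _ ((r1 * h1) ^+ 3 * h1)).
  by rewrite ler_wpM2r ?lerXn2r ?nnegrE ?mulr_ge0 ?(ltW k10) ?(ltW r10) ?(ltW h10).
have -> : (r1 * h1) ^+ 3 * h1 = r1 ^+ 3 * h1 ^+ 4 by ring.
have r30 : 0 <= r1 ^+ 3 by rewrite exprn_ge0 // ltW.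
rewrite (ler_wpM2l r30) // lerXn2r // nnegrE ?(ltW h10) //.
by rewrite mulr_ge0 ?ler0n // ltW.
Qed.

Definition unbalanced_ratio (R : realType) (Q r q h : nat) : R :=
  (count_below (fun m => ~~ balanced (h %/ q) (r * h) m) (2 ^ (Q * h)))%:R
    / 2 ^+ (Q * h).

Lemma unbalanced_ratio_ge0 (R : realType) Q r q h : 0 <= unbalanced_ratio R Q r q h.
Proof. by rewrite divr_ge0 ?ler0n ?exprn_ge0. Qed.

Lemma geometric_absorb (R : realType) (c rho : R) : 0 < c -> 0 < rho < 1 ->
  exists2 n : nat, (0 < n)%N & exists2 sigma : R, 0 < sigma < 1 &
    forall D h, (n * D <= h)%N -> c ^+ D * rho ^+ h <= sigma ^+ h.
Proof.
move=> c0 /andP[rho0 rho1].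
have [n nP] : exists n, c * rho ^+ n <= 1.
  have : geometric c rho @ \oo --> 0.
    by apply: cvg_geometric; rewrite ger0_norm // ltW.
  move=> /cvgr_le /(_ 1 ltr01)[n _ /(_ n)] /= nP.
  by exists n; apply: nP.
(* Half of the decay rho^h pays for c^D, the other half is kept. *)
exists n.*2.+1 => //; exists (Num.sqrt rho).
  by rewrite sqrtr_gt0 rho0 -[ltRHS]sqrtr1 ltr_sqrt.
move=> D h leD; have lenD : (n * D <= h)%N by lia.
rewrite -(subnKC lenD) [rho ^+ _]exprD exprM mulrA -exprMn.
set t := (h - n * D)%N; have s0 : 0 <= Num.sqrt rho by rewrite sqrtr_ge0.
apply: (@le_trans _ _ (rho ^+ t)).
  apply: ler_piMl; first by rewrite exprn_ge0 // ltW.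
  by apply: exprn_ile1 => //; rewrite mulr_ge0 ?exprn_ge0 // ltW.
rewrite -[in leLHS](sqr_sqrtr (ltW rho0)) -exprM ler_wiXn2l //.
  by rewrite -[leRHS]sqrtr1 ler_sqrt // ltW.
rewrite /t; lia.
Qed.

(** If the window starting at time r h is bad, then either the trajectory was already
    unbalanced with the finer tolerance h / q', or it is counted by
    [count_preimage_unbalanced].  The tolerance h / q' is chosen after the
    rate rho of the window, which depends on q. *)
Lemma unbalanced_ratio_step (R : realType) Q r q :
  (4 ^ r.+1 <= 3 ^ r * 4 ^ Q)%N -> (0 < q)%N ->
  exists2 q' : nat, (0 < q')%N & exists C sigma : R, 0 < sigma < 1 /\
    forall h, unbalanced_ratio R Q r.+1 q h
       <= unbalanced_ratio R Q r q' h + C * sigma ^+ h.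
Proof.
move=> leQ q0; have q20 : (0 < 2 * q)%N by lia.
have [rho rhoP cntP] := @count_unbalanced R (2 * q) q20.
have [n n0 [sigma sigmaP absorb]] := geometric_absorb (ltr0Sn R 511) rhoP.
pose q' := (2 * q + n)%N; have q'0 : (0 < q')%N by rewrite /q'; lia.
exists q' => //; exists (12 * r.+1%:R ^+ 3 * q'%:R ^+ 4); exists sigma; split=> // h.
rewrite /unbalanced_ratio; set X : R := 2 ^+ _; have X0 : 0 < X by rewrite exprn_gt0.
rewrite ler_pdivrMr // mulrDl divfK ?gt_eqF //.
pose D := (h %/ q')%N; pose B n := ~~ balanced (h %/ (2 * q)) h n.
have ltq : (h < D.+1 * q')%N by rewrite -ltn_divLR.
have := count_preimage_unbalanced leQ ltq (andP rhoP).1 (cntP h).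
rewrite -/X -/B => cnt.
have leD : (D + h %/ (2 * q) <= h %/ q)%N.
  have leDE : (D <= h %/ (2 * q))%N by apply: leq_div2l => //; rewrite /q'; lia.
  apply: (@leq_trans (h %/ (2 * q) * 2)).
    by rewrite muln2 -addnn leq_add2r.
  by rewrite leq_divRL // -mulnA leq_trunc_div.
have leU : (count_below (fun m => ~~ balanced (h %/ q) (r.+1 * h) m) (2 ^ (Q * h))
   <= count_below (fun m => ~~ balanced D (r * h) m) (2 ^ (Q * h)) +
    count_below (fun m => balanced D (r * h) m && B (iter (r * h) collatzT m))
      (2 ^ (Q * h)))%N.
  apply: count_below_subU => m _; apply: contraR.
  rewrite negb_or negbK /B => /andP[bal]; rewrite bal /= negbK => bal2.
  by rewrite mulSnr; apply: balanced_extend leD bal bal2.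
rewrite -(ler_nat R) natrD in leU; apply: (le_trans leU); rewrite lerD2l.
apply: (le_trans cnt); apply: ler_wpM2r; first exact: ltW.
apply: ler_wpM2l; first by rewrite !mulr_ge0 ?exprn_ge0.
apply: absorb; apply: leq_trans (leq_trunc_div h q').
by rewrite mulnC leq_mul2l /q' leq_addl orbT.
Qed.

Lemma unbalanced_ratio_cvg0 (R : realType) Q r q :
  (forall t, (t < r)%N -> (4 ^ t.+1 <= 3 ^ t * 4 ^ Q)%N) -> (0 < q)%N ->
  unbalanced_ratio R Q r q @ \oo --> (0 : R).
Proof.
elim: r q => [|r IHr] q leQ q0.
  rewrite (_ : unbalanced_ratio R Q 0 q = cst 0); first exact: cvg_cst.
  apply/funext => h; rewrite /unbalanced_ratio.
  rewrite (_ : count_below _ _ = 0)%N ?mul0r // /count_below.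
  by rewrite (@eq_count _ _ pred0) ?count_pred0 // => m; rewrite mul0n balanced0.
have [q' q'0 [C [sigma [/andP[sig0 sig1] step]]]] :=
  unbalanced_ratio_step R (leQ r (ltnSn r)) q0.
apply: (@squeeze_cvgr _ _ _ _ (cst 0)
   (unbalanced_ratio R Q r q' \+ geometric C sigma)).
- by near=> h; rewrite unbalanced_ratio_ge0 /=; apply: step.
- exact: cvg_cst.
- rewrite -[X in _ --> X]addr0; apply: cvgD.
    by apply: IHr => // t ltt; apply: leQ; apply: ltnW.
  by apply: cvg_geometric; rewrite ger0_norm // ltW.
Unshelve. all: by end_near. Qed.

(** * Balanced trajectories follow the mean drift *)

Section Drift.
Variable R : rcfType.
Local Notation kappa := (Num.sqrt 3 / 2 : R).

Lemma drift_gt0 : 0 < kappa.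
Proof. by rewrite divr_gt0 ?sqrtr_gt0. Qed.

Lemma drift_lt1 : kappa < 1.
Proof. by rewrite ltr_pdivrMr // mul1r sqrt3_lt2. Qed.

(** The integer 5 is the least exponent with this property; it bounds the number
    of steps in [drift_tail]. *)
Lemma drift5_lt : kappa ^+ 5 < 2^-1.
Proof.
have := sqrt3_sqr R; have := sqrt3_gt1 R; set s := Num.sqrt 3 => s1 ss.
have -> : (s / 2) ^+ 5 = (s * s) * (s * s) * s / 32 by field.
rewrite ss; suff : s < 16 / 9 by lra.
by nra.
Qed.

Lemma balanced_iter_ge D k m : balanced D k m ->
  kappa ^+ k * m%:R <= (iter k collatzT m)%:R * 2 ^+ D.
Proof.
move=> /balancedP/(_ k (leqnn k))[lo _]; have aff := collatz_affine m k.
have P0 : 0 < 2 ^+ k :> R by rewrite exprn_gt0.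
rewrite expr_div_n mulrAC ler_pdivrMr //.
have le3 : Num.sqrt 3 ^+ k <= (3 ^ odd_steps m k)%:R * 2 ^+ D :> R.
  apply: sqrt3_expr_ge; first by rewrite mulr_ge0 ?exprn_ge0.
  rewrite -(natrX _ 2 D) -natrM -natrX ler_nat expnMn -!expnM.
  apply: (@leq_trans (3 ^ (odd_steps m k * 2) * 3 ^ D)).
    by rewrite -expnD leq_exp2l //; lia.
  have le34 : (3 ^ D <= 2 ^ (D * 2))%N.
    by rewrite mulnC expnM; case: (D) => // d; rewrite leq_exp2r.
  by rewrite leq_mul2l le34 orbT.
apply: (@le_trans _ _ ((3 ^ odd_steps m k * m)%:R * 2 ^+ D)).
  by rewrite natrM mulrAC ler_wpM2r.
rewrite mulrAC ler_wpM2r ?exprn_ge0 // mulrC -(natrX _ 2 k) -natrM ler_nat aff.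
exact: leq_addr.
Qed.

Lemma balanced_iter_le D k m : balanced D k m ->
  (iter k collatzT m)%:R <= kappa ^+ k * m%:R * 2 ^+ D + k%:R * 4 ^+ D.
Proof.
move=> bal; have off := offset_balanced (leqnn k) bal.
rewrite subnn /= expnD expnM in off.
have [_ hi] := balancedP _ _ _ bal k (leqnn k); have aff := collatz_affine m k.
have P0 : 0 < 2 ^+ k :> R by rewrite exprn_gt0.
rewrite -(ler_pM2l P0) -(natrX _ 2 k) -natrM aff natrD mulrDr natrX; apply: lerD.
  have -> : 2 ^+ k * (kappa ^+ k * m%:R * 2 ^+ D)
      = Num.sqrt 3 ^+ k * 2 ^+ D * m%:R.
    rewrite expr_div_n -!mulrA mulrCA; congr (_ * _).
    by rewrite mulVKf ?gt_eqF // mulrC.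
  rewrite natrM ler_wpM2r //.
  apply: le_trans (three_half_le R k D).
  by rewrite ler_nat leq_exp2l //; lia.
apply: (@le_trans _ _ (k * (2 ^ k * (2 ^ 2) ^ D))%:R); first by rewrite ler_nat.
by rewrite !natrM !natrX mulrCA lexx.
Qed.

(** The hypothesis on R1 says that after R1 h steps the expected size of an integer
    below 2^(Q h) is at most 2^h.  Each further 5 steps at least halve the expected
    size, which must stay at least 1. *)
Lemma drift_tail R1 Q h m l :
  (3 ^ R1 * 4 ^ Q <= 4 ^ R1.+1)%N -> (m < 2 ^ (Q * h))%N ->
  1 <= kappa ^+ (R1 * h + l) * m%:R ->
  kappa ^+ (R1 * h) * m%:R <= 2 ^+ h /\ (l <= 5 * h)%N.
Proof.
move=> leQ ltm ge1.
have k0 := drift_gt0; have k1 := drift_lt1.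
have leK : kappa ^+ (R1 * h) * m%:R <= 2 ^+ h.
  apply: (@le_trans _ _ (kappa ^+ (R1 * h) * (2 ^ (Q * h))%:R)).
    by rewrite ler_wpM2l ?exprn_ge0 ?ler_nat ?(ltW k0) // ltnW.
  rewrite expr_div_n mulrAC ler_pdivrMr ?exprn_gt0 // natrX -exprD.
  rewrite -ler_sqr ?nnegrE ?mulr_ge0 ?exprn_ge0 ?sqrtr_ge0 //.
  rewrite exprMn sqrt3_expr_sqr -!natrX -natrM ler_nat.
  have e4 n : ((2 ^ n) ^ 2 = 4 ^ n)%N by rewrite -expnM mulnC expnM.
  rewrite !e4 -mulSn.
  have : ((3 ^ R1 * 4 ^ Q) ^ h <= (4 ^ R1.+1) ^ h)%N.
    by case: (h) => // h'; rewrite leq_exp2r.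
  by rewrite expnMn -!expnM.
split=> //; rewrite leqNgt; apply/negP => ltl.
have : kappa ^+ (R1 * h + l) * m%:R < 1; last by rewrite ltNge ge1.
rewrite exprD mulrAC.
apply: (@le_lt_trans _ _ (2 ^+ h * kappa ^+ l)).
  by rewrite ler_wpM2r // exprn_ge0 // ltW.
apply: (@le_lt_trans _ _ (2 ^+ h * kappa ^+ (5 * h).+1)).
  by rewrite ler_wpM2l ?exprn_ge0 // ler_wiXn2l // ltW.
rewrite exprSr mulrA exprM -exprMn.
apply: le_lt_trans k1; apply: ler_piMl; first exact: ltW.
have k5 := drift5_lt; have k50 : 0 <= kappa ^+ 5 by rewrite exprn_ge0 // ltW.
by apply: exprn_ile1; [rewrite mulr_ge0 | lra].
Qed.
End Drift.

(** The bound on k in the theorem is the time at which the expected size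
    (sqrt 3 / 2)^k m reaches 1. *)
Lemma drift_ge1 (R : realType) (m k : nat) : (0 < m)%N ->
  k%:R <= log2 (m%:R : R) / (1 - log2 (Num.sqrt (3 : R))) ->
  1 <= (Num.sqrt 3 / 2) ^+ k * m%:R :> R.
Proof.
move=> m0; have s1 := sqrt3_gt1 R; have s2 := sqrt3_lt2 R.
have s0 : 0 < Num.sqrt 3 :> R by rewrite sqrtr_gt0.
have mR : 0 < m%:R :> R by rewrite ltr0n.
have ln2 : 0 < ln 2 :> R by rewrite ln_gt0 // ltr1n.
have lns : ln (Num.sqrt 3) < ln 2 :> R by rewrite ltr_ln ?posrE.
have -> : 1 - log2 (Num.sqrt 3) = (ln 2 - ln (Num.sqrt 3)) / ln 2 :> R.
  by rewrite /log2 mulrBl divff ?gt_eqF.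
rewrite /log2 ler_pdivlMr ?divr_gt0 ?subr_gt0 // mulrA ler_pdivrMr //.
rewrite divfK ?gt_eqF // => lek.
have K0 : 0 < (Num.sqrt 3 / 2) ^+ k :> R by rewrite exprn_gt0 ?drift_gt0.
rewrite -ler_ln ?posrE ?mulr_gt0 // ln1 lnM ?posrE //.
rewrite lnXn ?drift_gt0 // ln_div ?posrE // -[_ *+ k]mulr_natl.
lra.
Qed.

Section Deterministic.
Variables (R : rcfType).
Local Notation kappa := (Num.sqrt 3 / 2 : R).

(** Up to time R1 h balancedness gives both bounds directly, with errors absorbed by
    y.  At later times the expected size lies between 1 and 2^h <= y, so the lower
    bound is at most 1 and the upper bound is at least y, while the iterate is at most
    2^(5 h) times the one at time R1 h. *)
Lemma balanced_trajectory_bounds (R1 Q h m k : nat) (y : R) :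
  (3 ^ R1 * 4 ^ Q <= 4 ^ R1.+1)%N -> (0 < m < 2 ^ (Q * h))%N ->
  balanced h (R1 * h) m ->
  (R1.+1 * 2 ^ (8 * h))%:R <= y -> 1 <= kappa ^+ k * m%:R ->
  kappa ^+ k * (m%:R / y) <= (iter k collatzT m)%:R <= kappa ^+ k * (m%:R * y).
Proof.
move=> leQ /andP[m0 ltm] bal leY ge1; set K := (R1 * h)%N in bal.
have K0 : 0 < kappa by apply: drift_gt0.
have [m4 m7] : (R1.+1 * 2 ^ h * 4 ^ h <= R1.+1 * 2 ^ (8 * h) /\
   R1.+1 * 2 ^ h * 2 ^ (7 * h) <= R1.+1 * 2 ^ (8 * h))%N.
  have -> : (4 ^ h = 2 ^ (2 * h))%N by rewrite expnM.
  by rewrite -!mulnA !leq_mul2l -!expnD !leq_exp2l //; split; apply/orP; right; lia.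
have hle : (R1 * h + 1 <= R1.+1 * 2 ^ h)%N.
  have := ltn_expl h (isT : 1 < 2)%N; move: (2 ^ h)%N => H ltH; nia.
have H1 : 1 <= 2 ^+ h :> R by rewrite exprn_ege1 ?ler1n.
have HH : 2 ^+ h <= 4 ^+ h :> R by rewrite lerXn2r ?nnegrE ?ler_nat.
have le4y : ((R1 * h + 1) * 4 ^ h)%:R <= y.
  by apply: le_trans leY; rewrite ler_nat (leq_trans _ m4) // leq_mul2r hle orbT.
have le7y : ((R1 * h + 1) * 2 ^ (7 * h))%:R <= y.
  by apply: le_trans leY; rewrite ler_nat (leq_trans _ m7) // leq_mul2r hle orbT.
have K1 : 1 <= (R1 * h + 1)%:R :> R by rewrite ler1n addn1.
rewrite natrM natrX in le4y.
have y4 : 4 ^+ h <= y.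
  by apply: le_trans le4y; rewrite ler_peMl ?exprn_ge0.
have y0 : 0 < y by lra.
have m0R : 0 < m%:R :> R by rewrite ltr0n.
rewrite [_ * (_ / _)]mulrA [_ * (_ * y)]mulrA.
set V := kappa ^+ k * m%:R in ge1 *.
have V0 : 0 < V by lra.
have [lek|/ltnW ltk] := leqP k K.
  have balk : balanced h k m.
    apply/balancedP => i leik; have /balancedP bal' := bal.
    exact: bal' (leq_trans leik lek).
  apply/andP; split.
    rewrite ler_pdivrMr //; apply: le_trans (balanced_iter_ge R balk) _.
    by rewrite ler_wpM2l //; lra.
  apply: le_trans (balanced_iter_le R balk) _; rewrite -/V.
  apply: (@le_trans _ _ (V * ((R1 * h + 1)%:R * 4 ^+ h))); last first.
    by rewrite ler_wpM2l // ltW.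
  have lekR : k%:R <= (R1 * h)%:R :> R by rewrite ler_nat.
  have : k%:R * 4 ^+ h <= V * ((R1 * h)%:R * 4 ^+ h).
    apply: (@le_trans _ _ ((R1 * h)%:R * 4 ^+ h)).
      by rewrite ler_wpM2r ?exprn_ge0.
    by rewrite ler_peMl // mulr_ge0 ?exprn_ge0.
  have : V * 2 ^+ h <= V * 4 ^+ h by rewrite ler_wpM2l // ltW.
  by rewrite natrD; lra.
have def_k : k = (K + (k - K))%N by rewrite subnKC.
move: ge1; rewrite /V {1}def_k => ge1.
have [leK lel] := drift_tail leQ ltm ge1.
move: (def_k) ge1; set l := (k - K)%N => -> ge1.
have Kl : kappa ^+ l <= 1.
  by apply: exprn_ile1; [apply: ltW | rewrite ltW // drift_lt1].
apply/andP; split.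
  apply: (@le_trans _ _ 1); last by rewrite ler1n iter_collatzT_gt0.
  rewrite ler_pdivrMr // mul1r exprD mulrAC.
  apply: (@le_trans _ _ (kappa ^+ K * m%:R)).
    by rewrite ler_piMr // mulr_ge0 ?exprn_ge0 // ltW.
  by apply: (le_trans leK); lra.
apply: (@le_trans _ _ y); last by rewrite ler_peMl // ltW.
apply: le_trans le7y.
apply: (@le_trans _ _ (2 ^+ l * (iter K collatzT m)%:R)).
  by rewrite addnC iterD -natrX -natrM ler_nat iter_collatzT_le.
have -> : ((R1 * h + 1) * 2 ^ (7 * h))%:R
    = 2 ^+ (5 * h) * ((R1 * h + 1)%:R * 4 ^+ h) :> R.
  rewrite natrM natrX mulrCA; congr (_ * _).
  by rewrite -[4]/((2 * 2)%:R) natrM -expr2 -exprM -exprD; congr (_ ^+ _); lia.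
apply: ler_pM; rewrite ?exprn_ge0 //; first by rewrite ler_weXn2l ?ler1n.
apply: le_trans (balanced_iter_le R bal) _.
have : kappa ^+ K * m%:R * 2 ^+ h <= 4 ^+ h.
  apply: (@le_trans _ _ (2 ^+ h * 2 ^+ h)).
    by rewrite ler_wpM2r // exprn_ge0.
  by rewrite -exprMn -natrM.
rewrite natrD /K; lra.
Qed.

End Deterministic.

Lemma powR_ge_of_expn (R : realType) (eps : R) (E G m : nat) :
  0 < eps -> 1 <= E%:R * eps -> (0 < G)%N -> (G ^ E <= m)%N ->
  G%:R <= m%:R `^ eps.
Proof.
move=> eps0 leE G0 leGm.
have G1 : 1 <= G%:R :> R by rewrite ler1n.
apply: (@le_trans _ _ ((G ^ E)%:R `^ eps)); last first.
  by apply: ge0_ler_powR; rewrite ?nnegrE ?ler_nat // ltW.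
rewrite natrX -powR_mulrn ?ler0n // -powRrM -[leLHS]powRr1 ?ler0n //.
exact: ler_powR.
Qed.

(** * Natural density one from vanishing exceptional sets *)

Lemma count_below_lt L n : (count_below (fun m => m < L)%N n <= L)%N.
Proof.
rewrite /count_below -size_filter -[leqRHS](size_iota 0).
apply: uniq_leq_size; first by rewrite filter_uniq ?iota_uniq.
by move=> m; rewrite mem_filter !mem_iota /= => /andP[].
Qed.

Lemma count_upto_le (A : set nat) n : (count_upto A n <= n)%N.
Proof.
rewrite /count_upto big_mkcond; apply: (@leq_trans (\sum_(1 <= m < n.+1) 1)%N).
  by apply: leq_sum => i _; case: ifP.
by rewrite sum_nat_const_nat muln1 subn1.
Qed.

Lemma count_upto_exceptions (A : set nat) (exc : pred nat) n X : (n < X)%N ->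
  (forall m, (0 < m < X)%N -> ~~ exc m -> A m) ->
  (n <= count_upto A n + count_below exc X)%N.
Proof.
move=> ltnX Aexc; rewrite /count_upto big_mkcond.
have -> : count_below exc X = (\sum_(0 <= m < X) exc m)%N.
  by rewrite count_below_sum big_mkord.
apply: (@leq_trans (\sum_(1 <= m < n.+1)
    ((if m \in A then 1 else 0) + exc m))%N).
  apply: (@leq_trans (\sum_(1 <= m < n.+1) 1)%N).
    by rewrite sum_nat_const_nat muln1 subn1.
  rewrite big_nat_cond [leqRHS]big_nat_cond; apply: leq_sum => m.
  rewrite andbT => /andP[m0 ltm].
  have [//|nexc] := boolP (exc m); first by rewrite addn1.
  rewrite mem_set //; apply: Aexc => //; rewrite m0 /=.
  exact: leq_trans ltm ltnX.
rewrite big_split leq_add2l /= [leqRHS](@big_cat_nat _ _ _ n.+1) //=.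
rewrite [X in (X + _)%N](@big_cat_nat _ _ _ 1) //=.
by rewrite -addnA [leqRHS]addnCA leq_addr.
Qed.

Lemma trunc_log_cvg p : (1 < p)%N -> trunc_log p @ \oo --> \oo.
Proof.
move=> p1; apply/cvgnyPge => N; near=> n; apply: trunc_log_max => //.
by near: n; apply: nbhs_infty_ge.
Unshelve. all: by end_near. Qed.

(** The exceptional sets live on the sparse scales 2^(Q h).  For other n one uses the
    next scale, which is at most 2^Q n; the constant factor 2^Q is harmless. *)
Lemma density_one_of_exceptions (R : realType) (A : set nat) (Q : nat)
    (exc : nat -> pred nat) : (0 < Q)%N ->
  (forall h m, (0 < m < 2 ^ (Q * h))%N -> ~~ exc h m -> A m) ->
  (fun h => (count_below (exc h) (2 ^ (Q * h)))%:R / 2 ^+ (Q * h) : R)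
    @ \oo --> (0 : R) ->
  natural_density_one R A.
Proof.
move=> Q0 Aexc; set g := (fun h => _) => g0.
rewrite /natural_density_one.
suff : (fun n => (count_upto A n)%:R / n%:R : R) @ \oo --> (1 : R).
  move=> u1; apply: (cvg_limn_einf_sup _).1.
  by apply: cvg_EFin => //; near=> n.
have p1 : (1 < 2 ^ Q)%N by rewrite -{1}(expn0 2) ltn_exp2l.
apply: (@squeeze_cvgr _ _ _ _
   (fun n => 1 - 2 ^+ Q * g (trunc_log (2 ^ Q) n).+1) (cst 1)).
- near=> n; have n0 : (0 < n)%N by near: n; apply: nbhs_infty_gt.
  have nR : 0 < n%:R :> R by rewrite ltr0n.
  rewrite ler_pdivrMr // mul1r ler_nat count_upto_le andbT.
  set t := trunc_log _ _; set h := t.+1.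
  have ltn : (n < 2 ^ (Q * h))%N by rewrite expnM trunc_log_ltn.
  have := count_upto_exceptions ltn (Aexc h).
  rewrite -(ler_nat R) natrD => le_n.
  have X0 : 0 < 2 ^+ (Q * h) :> R by rewrite exprn_gt0.
  have gh0 : 0 <= g h by rewrite divr_ge0 // ltW.
  have leX : 2 ^+ (Q * h) <= 2 ^+ Q * n%:R :> R.
    rewrite -!natrX -natrM ler_nat mulnS expnD leq_mul2l expnM.
    by rewrite trunc_logP ?orbT.
  have def_bad : (count_below (exc h) (2 ^ (Q * h)))%:R = g h * 2 ^+ (Q * h).
    by rewrite /g divfK ?gt_eqF.
  rewrite def_bad in le_n; have := ler_wpM2l gh0 leX.
  by rewrite ler_pdivlMr //; lra.
- rewrite -[X in _ --> X]subr0 -[X in _ - X](mulr0 (2 ^+ Q)).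
  apply: cvgB; first exact: cvg_cst.
  apply: cvgMl_tmp.
  apply: (@cvg_comp _ _ _ (fun n => (trunc_log (2 ^ Q) n).+1) g _ \oo) => //.
  apply: (@cvg_comp _ _ _ (trunc_log (2 ^ Q)) (addn 1) _ \oo).
    exact: trunc_log_cvg.
  exact: cvg_addnl.
- exact: cvg_cst.
Unshelve. all: by end_near. Qed.

(** * Choice of the scales *)

(** R1 is the first window at whose beginning the expected size
    (sqrt 3 / 2)^(R1 h) 2^(Q h) is at most 2^h; the condition holds for r = 6 Q
    because 3^6 4 <= 4^6. *)
Lemma exists_last_window Q : exists R1, (3 ^ R1 * 4 ^ Q <= 4 ^ R1.+1)%N /\
  forall t, (t < R1)%N -> (4 ^ t.+1 <= 3 ^ t * 4 ^ Q)%N.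
Proof.
have exR : exists r, (3 ^ r * 4 ^ Q <= 4 ^ r.+1)%N.
  exists (6 * Q)%N; rewrite expnS !expnM -expnMn.
  by apply: leq_trans (leq_pmull _ _) => //; case: Q => // Q; rewrite leq_exp2r.
exists (ex_minn exR); case: ex_minnP => r leR minR; split=> // t ltr.
by rewrite leqNgt; apply/negP => /ltnW /minR; rewrite leqNgt ltr.
Qed.

Theorem theorem1p1 (R : realType) (eps : R) (eps_gt0 : 0 < eps) :
  natural_density_one R
    [set m : nat | (0 < m)%N /\
      forall k : nat,
        k%:R <= log2 (m%:R : R) / (1 - log2 (Num.sqrt (3 : R))) ->
        (Num.sqrt 3 / 2) ^+ k * m%:R `^ (1 - eps)
          <= (iter k collatzT m)%:R :> R /\
        (iter k collatzT m)%:R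
          <= (Num.sqrt 3 / 2) ^+ k * m%:R `^ (1 + eps) :> R].
Proof.
pose E := (Num.bound eps^-1).+1.
have leE : 1 <= E%:R * eps.
  rewrite -ler_pdivrMr // div1r ltW //.
  apply: lt_le_trans (archi_boundP _) _; first by rewrite invr_ge0 ltW.
  by rewrite ler_nat.
(* G h ^ E is about 2^(8 E h), negligible against 2^(Q h). *)
pose Q := (9 * E)%N; have [R1 [leR1 ltR1]] := exists_last_window Q.
pose G h := (R1.+1 * 2 ^ (8 * h))%N.
pose exc h m := (m < G h ^ E)%N || ~~ balanced h (R1 * h) m.
apply: (@density_one_of_exceptions R _ Q exc) => //.
  move=> h m m0X; rewrite /exc negb_or negbK -leqNgt => /andP[leGm bal].
  have [m0 ltm] := andP m0X; split=> // k lek.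
  have mR0 : m%:R != 0 :> R by rewrite pnatr_eq0 -lt0n.
  have G0 : (0 < G h)%N by rewrite muln_gt0 expn_gt0.
  have leY := powR_ge_of_expn eps_gt0 leE G0 leGm.
  have := balanced_trajectory_bounds leR1 m0X bal leY (drift_ge1 m0 lek).
  rewrite !powRD ?mR0 ?implybT // powRN powRr1 ?ler0n // => /andP[] //.
apply: (@squeeze_cvgr _ _ _ _ (cst 0)
   (geometric (R1.+1%:R ^+ E) (2 ^- E) \+ unbalanced_ratio R Q R1 1)).
- near=> h; apply/andP; split; first by rewrite divr_ge0 ?exprn_ge0.
  rewrite /= /unbalanced_ratio divn1.
  set X : R := 2 ^+ (Q * h); have X0 : 0 < X by rewrite exprn_gt0.
  rewrite ler_pdivrMr // mulrDl divfK ?gt_eqF //.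
  have -> : R1.+1%:R ^+ E * (2 ^- E) ^+ h * X = (G h ^ E)%:R.
    rewrite /G expnMn natrM natrX -mulrA -expnM natrX; congr (_ * _).
    rewrite -exprVn -exprM exprVn /X.
    have -> : (Q * h = E * h + 8 * h * E)%N by rewrite /Q; lia.
    by rewrite exprD mulKf // gt_eqF // exprn_gt0.
  rewrite -natrD ler_nat.
  apply: (@leq_trans (count_below (fun m => m < G h ^ E)%N (2 ^ (Q * h))
    + count_below (fun m => ~~ balanced h (R1 * h) m) (2 ^ (Q * h)))).
    exact: count_below_subU.
  by rewrite leq_add2r count_below_lt.
- exact: cvg_cst.
- rewrite -[X in _ --> X]addr0; apply: cvgD.
    apply: cvg_geometric; rewrite ger0_norm ?invr_ge0 ?exprn_ge0 //.
    by rewrite invf_lt1 ?exprn_gt0 // exprn_egt1 // ltr1n.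
  exact: unbalanced_ratio_cvg0.
Unshelve. all: by end_near. Qed.
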